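(* For every rational number $\alpha$ with $0 < \alpha \leq 1$ there exists a finite semigroup $S$ with $\chi(S) = \alpha$.
   Context: Let $S$ be a semigroup. A relation $\rho \subseteq S \times S$ is compatible if $(x,y),(z,t) \in \rho$ implies $(xz,yt) \in \rho$. A congruence on $S$ is a compatible equivalence relation on $S$. A diagonal subsemigroup on $S$ is a reflexive compatible relation on $S$, i.e. a subsemigroup of the direct square $S \times S$ containing $\{(s,s) : s \in S\}$. Let $\mathrm{Cong}(S)$ and $\mathrm{Diag}(S)$ denote the set of congruences on $S$ and the set of diagonal subsemigroups on $S$, respectively. For finite $S$ the DSC coefficient of $S$ is $\chi(S) = |\mathrm{Cong}(S)|/|\mathrm{Diag}(S)|$. *)

(* Defs.v *)
From HB Require Import structures.
From mathcomp Require Import all_boot all_order all_algebra.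

Set Implicit Arguments.
Unset Strict Implicit.
Unset Printing Implicit Defensive.

(* A finite semigroup is a finType S together with a bundled associative
   operation mul : SemiGroup.law S. (A join of semigroupType and finType cannot
   be added to the Hierarchy-Builder hierarchy once finStarMonoidType exists.) *)
Section DiagonalSubsemigroups.
Variables (S : finType) (mul : SemiGroup.law S).
Implicit Type rho : {set S * S}.

Definition reflexive_on rho : bool := [forall x, (x, x) \in rho].

Definition symmetric_on rho : bool :=
  [forall x, forall y, ((x, y) \in rho) ==> ((y, x) \in rho)].

Definition transitive_on rho : bool :=
  [forall x, forall y, forall z,
     ((x, y) \in rho) && ((y, z) \in rho) ==> ((x, z) \in rho)].

Definition equivalence_on rho : bool :=
  [&& reflexive_on rho, symmetric_on rho & transitive_on rho].

Definition compatible rho : bool :=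
  [forall x, forall y, forall z, forall t,
     ((x, y) \in rho) && ((z, t) \in rho) ==> ((mul x z, mul y t) \in rho)].

Definition Cong : {set {set S * S}} :=
  [set rho | equivalence_on rho && compatible rho].

Definition Diag : {set {set S * S}} :=
  [set rho | reflexive_on rho && compatible rho].

Definition DSC_coefficient : rat := (#|Cong|%:R / #|Diag|%:R)%R.

End DiagonalSubsemigroups.

(* Main.v *)
Require Import Defs.
From mathcomp Require Import all_boot all_order all_algebra.
From HB Require Import structures.
From mathcomp Require Import all_fingroup all_solvable.
From mathcomp Require Import zify.

Set Implicit Arguments.
Unset Strict Implicit.
Unset Printing Implicit Defensive.

(** The examples are Rees matrix semigroups S = K x G x K over a finite group G,
    with a sandwich matrix that is trivial except for one element a of G repeated
    on the diagonal (outside one base index o).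

    Idempotents of S that lie in different rows or columns can be related by a
    diagonal subsemigroup rho only if the normal subgroup N that rho induces on
    the maximal subgroups contains a: modulo N, relating two indices identifies
    the corresponding rows or columns of the sandwich matrix.  Once a lies in N,
    the quotient of S by N is a direct product of G / N and a rectangular band,
    and the relations R and Q that rho induces on the two index sets are arbitrary
    reflexive relations.  So diagonal subsemigroups correspond to triples (N, R, Q)
    with a in N or R = Q = equality ([Diag_rees]), and congruences to the triples
    in which R and Q are equivalences ([Cong_rees]).  Let m be the number of normal
    subgroups containing a, r the number of the other ones, and let K have d
    reflexive relations and c equivalence relations.  Then ([DSC_rees])
    chi(S) = (m c^2 + r) / (m d^2 + r).

    In a cyclic group of order a power of 2 the subgroups form a chain, so every
    pair (m, r) with m positive occurs ([cyclic_2group_chain]).  To reach a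
    fraction u / v < 1 one solves (m c^2 + r) v = (m d^2 + r) u by m = v - u and
    r = u d^2 - v c^2.  The latter has to be nonnegative, which is arranged by
    taking K large, since c / d then becomes small ([leq_card_equivalences]).
    The value 1 is obtained from a one-element K, for which c = d. *)

(** * Reflexive relations and equivalences on a finite set *)

Lemma equivalence_onP (S : finType) (R : {set S * S}) :
  reflect [/\ forall x, (x, x) \in R,
   forall x y, (x, y) \in R -> (y, x) \in R &
   forall x y z, (x, y) \in R -> (y, z) \in R -> (x, z) \in R] (equivalence_on R).
Proof.
apply: (iffP and3P) => -[r s t]; split.
- exact/forallP.
- by move=> x y; move/forallP/(_ x)/forallP/(_ y)/implyP: s.
- move=> x y z xy yz.
  by move/forallP/(_ x)/forallP/(_ y)/forallP/(_ z)/implyP: t; rewrite xy yz => ->.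
- exact/forallP.
- by apply/forallP=> x; apply/forallP=> y; apply/implyP; apply: s.
- apply/forallP=> x; apply/forallP=> y; apply/forallP=> z.
  by apply/implyP=> /andP[]; apply: t.
Qed.

Section Families.
Variable K : finType.
Implicit Type R : {set K * K}.

Definition reflexives : {set {set K * K}} := [set R | reflexive_on R].
Definition equivalences : {set {set K * K}} := [set R | equivalence_on R].

Lemma reflexivesP R : reflect (forall x, (x, x) \in R) (R \in reflexives).
Proof. by rewrite inE; apply: forallP. Qed.

Lemma equivalences_reflexive R : R \in equivalences -> R \in reflexives.
Proof. by rewrite !inE => /and3P[]. Qed.

Lemma equivalencesP R : reflect [/\ forall x, (x, x) \in R,
   forall x y, (x, y) \in R -> (y, x) \in R &
   forall x y z, (x, y) \in R -> (y, z) \in R -> (x, z) \in R] (R \in equivalences).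
Proof. by rewrite inE; apply: equivalence_onP. Qed.

Definition diagonal : {set K * K} := [set x | x.1 == x.2].

Lemma diagonal_equivalence : diagonal \in equivalences.
Proof.
by apply/equivalencesP; split=> [x|x y|x y z]; rewrite !inE //= => /eqP->.
Qed.

Lemma diagonal_reflexive : diagonal \in reflexives.
Proof. exact/equivalences_reflexive/diagonal_equivalence. Qed.

End Families.

Section Toggle.
Variables (K : finType) (o : K).

(** An equivalence contains (o, t) exactly when it contains (t, o); after
    toggling, this fails for the single element t, so that t, and then E, can
    be read off from the toggled relation. *)
Definition toggle (E : {set K * K}) (t : K) : {set K * K} :=
  [set x | (x \in E) (+) (x == (o, t))].

Lemma toggle_inj (E E' : {set K * K}) (t t' : K) :
  E \in equivalences K -> E' \in equivalences K -> t != o -> t' != o ->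
  toggle E t = toggle E' t' -> (E, t) = (E', t').
Proof.
move=> /equivalencesP[_ sE _] /equivalencesP[_ sE' _] to to' eqT.
have e x : (x \in E) (+) (x == (o, t)) = (x \in E') (+) (x == (o, t')).
  by have := congr1 (fun A : {set _} => x \in A) eqT; rewrite !inE.
have syE x y : ((x, y) \in E) = ((y, x) \in E) by apply/idP/idP; apply: sE.
have syE' x y : ((x, y) \in E') = ((y, x) \in E') by apply/idP/idP; apply: sE'.
have tt' : t = t'.
  apply/eqP; have := e (o, t); have := e (t, o).
  rewrite !xpair_eqE !eqxx [o == t]eq_sym (negbTE to) /= (syE t) (syE' t) !addbF.
  by move=> <-; case: (_ \in E); case: (t == t').
rewrite -tt'; congr (_, _); apply/setP=> x.
by have := e x; rewrite -tt' => /addIb.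
Qed.

(** Every equivalence yields |K| - 1 reflexive relations by toggling one of the
    pairs (o, t) with t distinct from o, and the results are pairwise distinct;
    hence equivalences are as rare as desired among reflexive relations once K
    is large. *)
Lemma leq_card_equivalences :
  (#|K|.-1 * #|equivalences K| <= #|reflexives K|)%N.
Proof.
have -> : #|K|.-1 = #|[set t | t != o]|.
  by rewrite -(cardC1 o); apply: eq_card => t; rewrite !inE.
rewrite mulnC -cardsX -(@card_in_imset _ _ (fun u => toggle u.1 u.2)); last first.
  move=> [E t] [E' t']; rewrite !inE /= => /andP[eE to] /andP[eE' to'].
  by apply: toggle_inj; rewrite ?inE.
apply/subset_leq_card/subsetP=> R /imsetP[[E t]]; rewrite in_setX.
move=> /andP[/equivalencesP[rE _ _]].
rewrite inE => to ->; apply/reflexivesP=> x; rewrite inE rE /= xpair_eqE.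
by have [->|//] := eqVneq x o; rewrite eq_sym (negbTE to).
Qed.

End Toggle.

(** * Rees matrix semigroups and their diagonal subsemigroups *)

Lemma compatibleP (S : finType) (mul : SemiGroup.law S) (rho : {set S * S}) :
  reflect (forall s t u v, (s, t) \in rho -> (u, v) \in rho -> (mul s u, mul t v) \in rho)
    (compatible mul rho).
Proof.
apply: (iffP idP) => [c s t u v st uv | c].
  move/forallP/(_ s)/forallP/(_ t)/forallP/(_ u)/forallP/(_ v)/implyP: c.
  by rewrite st uv; apply.
do 4 apply/forallP=> ?; apply/implyP=> /andP[]; exact: c.
Qed.

Section ReesMatrix.
Local Open Scope group_scope.
Variables (K : finType) (o : K) (gT : finGroupType) (a : gT).
Implicit Types (N : {group gT}) (R Q : {set K * K}).
Implicit Type rho : {set (K * gT * K) * (K * gT * K)}.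
Local Notation diagonal := (diagonal K).
Local Notation reflexives := (reflexives K).
Local Notation equivalences := (equivalences K).

(** The row and the column of the base index o are trivial, so that the elements
    (o, g, o) multiply as in G; the matrix still separates any two indices by
    the entry a. *)
Definition sandwich (l i : K) : gT := if (l == i) && (i != o) then a else 1.

Definition rees_mul (s t : K * gT * K) : K * gT * K :=
  let: (i, g, l) := s in let: (j, h, m) := t in (i, g * sandwich l j * h, m).

Lemma rees_mulA : associative rees_mul.
Proof. by move=> [[i g] l] [[j h] m] [[k f] n]; rewrite /= !mulgA. Qed.

HB.instance Definition _ := SemiGroup.isLaw.Build (K * gT * K)%type rees_mul rees_mulA.

Lemma sandwich_ol i : sandwich o i = 1.
Proof. by rewrite /sandwich; case: eqP => // <-; rewrite eqxx. Qed.

Lemma sandwich_or l : sandwich l o = 1.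
Proof. by rewrite /sandwich eqxx andbF. Qed.

Definition rees_rel N R Q : {set (K * gT * K) * (K * gT * K)} :=
  [set st | [&& (st.1.1.1, st.2.1.1) \in R, N :* st.1.1.2 == N :* st.2.1.2
              & (st.1.2, st.2.2) \in Q]].

Lemma rees_relE N R Q i g l j h m :
  ((i, g, l), (j, h, m)) \in rees_rel N R Q
    = [&& (i, j) \in R, N :* g == N :* h & (l, m) \in Q].
Proof. by rewrite inE. Qed.

(** The triples (N, R, Q) for which [rees_rel N R Q] is compatible: the last
    condition says that related indices have the same sandwich entries modulo
    N. *)
Definition rees_data (F : {set {set K * K}}) :
    {set {group gT} * {set K * K} * {set K * K}} :=
  [set t : {group gT} * {set K * K} * {set K * K} |
     [&& t.1.1 <| [set: gT], t.1.2 \in F, t.2 \in F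
            & (a \in t.1.1) || (t.1.2 == diagonal) && (t.2 == diagonal)]].

(** If a is in N then R and Q range freely over F; otherwise N determines the
    triple. *)
Lemma card_rees_data (F : {set {set K * K}}) : diagonal \in F ->
  #|rees_data F| = (#|[set N : {group gT} | (N <| [set: gT]) && (a \in N)]| * #|F| ^ 2
                   + #|[set N : {group gT} | (N <| [set: gT]) && (a \notin N)]|)%N.
Proof.
move=> dF.
rewrite -(cardsID [set t : {group gT} * {set K * K} * {set K * K} | a \in t.1.1]).
congr (_ + _)%N.
  rewrite -mulnn mulnA -!cardsX; apply: eq_card => -[[N R] Q]; rewrite !inE /=.
  by case: (a \in N); rewrite ?andbF ?andbT //= -!andbA.
pose f N : {group gT} * {set K * K} * {set K * K} := (N, diagonal, diagonal).
rewrite -[RHS](@card_imset _ _ f); last by move=> N M [].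
apply: eq_card => -[[N R] Q]; apply/idP/imsetP; rewrite !inE /=.
  case/and5P=> aN nN _ _; rewrite (negbTE aN) /= => /andP[/eqP-> /eqP->].
  by exists N; rewrite // inE nN.
by case=> M; rewrite inE => /andP[nM aM] [-> -> ->]; rewrite nM aM dF !eqxx orbT.
Qed.

Lemma rcoset1_eq N g : (N :* 1 == N :* g) = (g \in N).
Proof.
rewrite eq_sym; apply/eqP/idP => [/rcoset_eqP | Ng]; rewrite ?rcoset1 //.
exact: rcoset_id.
Qed.

(** Each component is recovered by evaluating the relation at pairs whose other
    components are trivial. *)
Lemma rees_rel_inj : {in rees_data reflexives &,
  injective (fun t => rees_rel t.1.1 t.1.2 t.2)}.
Proof.
move=> [[N R] Q] [[M R'] Q']; rewrite !inE /=.
case/and4P=> _ /forallP rR /forallP rQ _ /and4P[_ /forallP rR' /forallP rQ' _] eqr.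
have e s t := congr1 (fun A : {set _} => (s, t) \in A) eqr.
congr (_, _, _).
- apply/group_inj/setP=> g.
  have := e (o, 1, o) (o, g, o).
  by rewrite /= !rees_relE rR rR' rQ rQ' !andbT /= !rcoset1_eq.
- apply/setP=> -[i j]; have := e (i, 1, o) (j, 1, o).
  by rewrite /= !rees_relE rQ rQ' !eqxx !andbT.
- apply/setP=> -[i j]; have := e (o, 1, i) (o, 1, j).
  by rewrite /= !rees_relE rR rR' !eqxx.
Qed.

(** Modulo N the sandwich factors of the two products agree, either because a is
    in N or because the indices involved are equal. *)
Lemma rees_rel_compat N R Q : (N, R, Q) \in rees_data reflexives ->
  forall s t u v, (s, t) \in rees_rel N R Q -> (u, v) \in rees_rel N R Q ->
  (rees_mul s u, rees_mul t v) \in rees_rel N R Q.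
Proof.
rewrite inE /= => /and4P[/andP[_ /subsetP nN] _ _ aRQ].
have cosetM x y : N :* (x * y) = (N :* x) * (N :* y).
  by rewrite rcoset_mul // nN ?inE.
move=> [[i g] l] [[j h] m] [[i' g'] l'] [[j' h'] m'].
rewrite /= !rees_relE => /and3P[Rij /eqP gh Qlm] /and3P[Rij' /eqP gh' Qlm'].
rewrite Rij Qlm' andbT /= !cosetM gh gh'.
suff -> : N :* sandwich l i' = N :* sandwich m j' by [].
case/orP: aRQ => [aN | /andP[/eqP dR /eqP dQ]].
  have sN k i1 : N :* sandwich k i1 = N.
    by rewrite /sandwich; case: ifP => _; rewrite ?mulg1 // rcoset_id.
  by rewrite !sN.
by move: Qlm Rij'; rewrite dR dQ !inE /= => /eqP-> /eqP->.
Qed.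

(** The converse: a diagonal subsemigroup rho is determined by its traces on the
    maximal subgroup at (o, o), on the idempotents (i, 1, o) and on the idempotents
    (o, 1, l). *)
Section Classification.
Variable rho : {set (K * gT * K) * (K * gT * K)}.
Hypothesis rho_refl : forall s, (s, s) \in rho.
Hypothesis rho_mul : forall s t u v, (s, t) \in rho -> (u, v) \in rho ->
  (rees_mul s u, rees_mul t v) \in rho.

Definition kernel_set : {set gT} := [set d | ((o, 1, o), (o, d, o)) \in rho].

Lemma kernel_group_set : group_set kernel_set.
Proof.
apply/group_setP; split; first by rewrite inE.
move=> x y; rewrite !inE => rx ry.
by have := rho_mul rx ry; rewrite /= !sandwich_ol !mulg1.
Qed.

Definition kernel : {group gT} := Group kernel_group_set.

Lemma kernel_normal : kernel <| [set: gT].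
Proof.
apply/andP; split; first exact: subsetT.
apply/subsetP=> x _; rewrite inE; apply/subsetP=> y /imsetP[d].
rewrite !inE => rd ->.
have := rho_mul (rho_mul (rho_refl (o, x^-1, o)) rd) (rho_refl (o, x, o)).
by rewrite /= !sandwich_ol !mulg1 mulVg conjgE mulgA.
Qed.

(** Diagonal subsemigroups of a finite group are congruences; here for the
    maximal subgroup at (o, o). *)
Lemma kernel_coset g h :
  (kernel :* g == kernel :* h) = (((o, g, o), (o, h, o)) \in rho).
Proof.
rewrite [LHS]eq_sym; apply/eqP/idP=> [/rcoset_eqP | gh].
  rewrite mem_rcoset inE => r.
  have := rho_mul r (rho_refl (o, g, o)).
  by rewrite /= !sandwich_ol !mulg1 mul1g mulgKV.
apply/rcoset_eqP; rewrite mem_rcoset inE.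
have := rho_mul gh (rho_refl (o, g^-1, o)).
by rewrite /= !sandwich_ol !mulg1 mulgV.
Qed.

Definition left_rel : {set K * K} := [set x | ((x.1, 1, o), (x.2, 1, o)) \in rho].
Definition right_rel : {set K * K} := [set x | ((o, 1, x.1), (o, 1, x.2)) \in rho].

(** Multiplying by the idempotent (o, 1, o) on both sides moves any pair of rho
    into the maximal subgroup at (o, o). *)
Lemma kernel_eq_coset i g l j h m :
  ((i, g, l), (j, h, m)) \in rho -> kernel :* g = kernel :* h.
Proof.
move=> r; apply/eqP; rewrite kernel_coset.
have := rho_mul (rho_mul (rho_refl (o, 1, o)) r) (rho_refl (o, 1, o)).
by rewrite /= !sandwich_ol !sandwich_or !mulg1 !mul1g.
Qed.

Lemma kernel_inv g h : kernel :* g = kernel :* h ->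
  ((o, g^-1, o), (o, h^-1, o)) \in rho.
Proof.
move/eqP; rewrite kernel_coset => r.
have := rho_mul (rho_mul (rho_refl (o, h^-1, o)) r) (rho_refl (o, g^-1, o)).
rewrite /= !sandwich_ol !mulg1 mulVg mul1g mulgK => r'.
by move: r'; rewrite -!kernel_coset eq_sym.
Qed.

(** A pair ((i, g, l), (j, h, m)) of rho yields pairs of idempotents on
    multiplication by ((o, g^-1, o), (o, h^-1, o)) from the right or the left,
    and is recovered from its three traces because
    (i, g, l) = (i, 1, o) (o, g, o) (o, 1, l). *)
Lemma rho_rees : rho = rees_rel kernel left_rel right_rel.
Proof.
apply/setP=> -[[[i g] l] [[j h] m]]; rewrite rees_relE.
apply/idP/and3P=> [r | [lij gh rlm]].
  have gh := kernel_eq_coset r; have r' := kernel_inv gh.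
  split; rewrite ?gh // inE /=.
    by have := rho_mul r r'; rewrite /= !sandwich_or !mulg1 !mulgV.
  by have := rho_mul r' r; rewrite /= !sandwich_ol !mulg1 !mulVg.
move: lij rlm; rewrite kernel_coset in gh; rewrite !inE /= => rij rlm.
have := rho_mul (rho_mul rij gh) rlm.
by rewrite /= !sandwich_ol !mulg1 !mul1g.
Qed.

(** Left multiplication by (o, 1, l) shows that the columns i and j of the sandwich
    matrix agree modulo the kernel in every row l.  If i differs from j, then one
    of the two is not o, and in that row the entries are a and 1. *)
Lemma left_rel_offdiag i j : (i, j) \in left_rel -> i != j -> a \in kernel.
Proof.
move=> r ij; move: (r); rewrite inE => {}r.
have k l : kernel :* sandwich l i = kernel :* sandwich l j.
  have := rho_mul (rho_refl (o, 1, l)) r.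
  by rewrite /= !mulg1 !mul1g => /kernel_eq_coset.
have [io | io] := eqVneq i o.
  have jo : j != o by rewrite -io eq_sym.
  rewrite -rcoset1_eq; move: (k j).
  by rewrite /sandwich eqxx jo [j == i]eq_sym (negbTE ij) => ->.
rewrite -rcoset1_eq; move: (k i).
by rewrite /sandwich eqxx io (negbTE ij) => ->.
Qed.

Lemma right_rel_offdiag i j : (i, j) \in right_rel -> i != j -> a \in kernel.
Proof.
move=> r ij; move: (r); rewrite inE => {}r.
have k l : kernel :* sandwich i l = kernel :* sandwich j l.
  have := rho_mul r (rho_refl (l, 1, o)).
  by rewrite /= !mulg1 !mul1g => /kernel_eq_coset.
have [io | io] := eqVneq i o.
  have jo : j != o by rewrite -io eq_sym.
  rewrite -rcoset1_eq; move: (k j).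
  by rewrite /sandwich eqxx jo (negbTE ij) => ->.
rewrite -rcoset1_eq; move: (k i).
by rewrite /sandwich eqxx io [j == i]eq_sym (negbTE ij) => ->.
Qed.

Lemma kernel_data : (kernel, left_rel, right_rel) \in rees_data reflexives.
Proof.
have lr : left_rel \in reflexives by apply/reflexivesP=> x; rewrite inE.
have rr : right_rel \in reflexives by apply/reflexivesP=> x; rewrite inE.
rewrite inE /= kernel_normal lr rr /=.
have [//|aN] := boolP (a \in kernel_set).
rewrite /=; apply/andP; split; apply/eqP/setP=> -[i j].
  rewrite [RHS]inE /=; apply/idP/eqP=> [r | ->]; last exact/reflexivesP.
  by apply/eqP/(contraNT _ aN)/(left_rel_offdiag r).
rewrite [RHS]inE /=; apply/idP/eqP=> [r | ->]; last exact/reflexivesP.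
by apply/eqP/(contraNT _ aN)/(right_rel_offdiag r).
Qed.

End Classification.

Definition rees_rel_of (t : {group gT} * {set K * K} * {set K * K}) :=
  rees_rel t.1.1 t.1.2 t.2.

Lemma Diag_rees : Diag rees_mul = rees_rel_of @: rees_data reflexives.
Proof.
apply/setP=> rho; apply/idP/imsetP.
  rewrite inE => /andP[/forallP rr /compatibleP rm].
  by exists (kernel rr rm, left_rel rho, right_rel rho);
    [apply: kernel_data | apply: rho_rees].
case=> -[[N R] Q] dt ->; rewrite inE; apply/andP; split.
  move: dt; rewrite inE => /and4P[_ /reflexivesP rR /reflexivesP rQ _].
  by apply/forallP=> -[[i g] l]; rewrite rees_relE rR rQ eqxx.
exact/compatibleP/rees_rel_compat.
Qed.

Lemma rees_rel_equivalence N R Q : R \in reflexives -> Q \in reflexives ->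
  equivalence_on (rees_rel N R Q) = (R \in equivalences) && (Q \in equivalences).
Proof.
move=> /reflexivesP rR /reflexivesP rQ; rewrite !inE.
apply/equivalence_onP/andP => [[_ s t] |].
  split; apply/equivalence_onP; split=> // i j.
  - by have := s (i, 1, o) (j, 1, o); rewrite !rees_relE !rQ !eqxx !andbT.
  - by move=> k; have := t (i, 1, o) (j, 1, o) (k, 1, o); rewrite !rees_relE;
      rewrite !rQ !eqxx !andbT.
  - by have := s (o, 1, i) (o, 1, j); rewrite !rees_relE !rR !eqxx.
  - by move=> k; have := t (o, 1, i) (o, 1, j) (o, 1, k); rewrite !rees_relE !rR !eqxx.
case=> /equivalence_onP[_ sR tR] /equivalence_onP[_ sQ tQ].
split=> [[[i g] l] | [[i g] l] [[j h] m] | [[i g] l] [[j h] m] [[k f] n]].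
- by rewrite rees_relE rR rQ eqxx.
- by rewrite !rees_relE eq_sym => /and3P[/sR-> -> /sQ->].
rewrite !rees_relE => /and3P[ij /eqP-> lm] /and3P[jk -> mn].
by rewrite (tR _ _ _ ij jk) (tQ _ _ _ lm mn).
Qed.

Lemma rees_dataS : rees_data equivalences \subset rees_data reflexives.
Proof.
apply/subsetP=> -[[N R] Q]; rewrite [in X in X -> _]inE /=.
case/and4P=> nN /equivalences_reflexive rR /equivalences_reflexive rQ aRQ.
by rewrite inE /= nN rR rQ.
Qed.

Lemma Cong_rees : Cong rees_mul = rees_rel_of @: rees_data equivalences.
Proof.
apply/setP=> rho; apply/idP/imsetP.
  rewrite inE => /andP[eqv comp].
  have : rho \in Diag rees_mul by rewrite inE comp andbT; case/and3P: eqv.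
  rewrite Diag_rees => /imsetP[[[N R] Q] dt def]; exists (N, R, Q) => //.
  move: dt; rewrite inE /= => /and4P[nN rR rQ aRQ].
  move: eqv; rewrite def /rees_rel_of rees_rel_equivalence // => /andP[eR eQ].
  by rewrite inE /= nN eR eQ.
case=> -[[N R] Q] dt ->; have := subsetP rees_dataS _ dt.
move/(imset_f rees_rel_of); rewrite -Diag_rees !inE => /andP[_ ->].
move: dt; rewrite inE /= => /and4P[_ eR eQ _].
by rewrite andbT rees_rel_equivalence ?equivalences_reflexive // eR.
Qed.

Lemma card_Diag_rees : #|Diag rees_mul| = #|rees_data reflexives|.
Proof. by rewrite Diag_rees card_in_imset //; apply: rees_rel_inj. Qed.

Lemma card_Cong_rees : #|Cong rees_mul| = #|rees_data equivalences|.
Proof.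
rewrite Cong_rees card_in_imset // => t u dt du.
by apply: rees_rel_inj; apply: (subsetP rees_dataS).
Qed.

End ReesMatrix.

(** * Chains of normal subgroups *)

(** Take G cyclic of order 2^(m-1+r), generated by x: its m + r subgroups are
    generated by the powers x^(2^j), and those containing x^(2^(m-1)) are the
    ones with j < m. *)
Lemma cyclic_2group_chain (m r : nat) : (0 < m)%N ->
  exists (gT : finGroupType) (a : gT),
    #|[set N : {group gT} | (N <| [set: gT])%g && (a \in N)]| = m /\
    #|[set N : {group gT} | (N <| [set: gT])%g && (a \notin N)]| = r.
Proof.
move=> m_gt0; pose e := (m.-1 + r)%N.
pose gT : finGroupType := 'I_(2 ^ e).-1.+1.
pose x : gT := Zp1.
have ox : #[x]%g = (2 ^ e)%N by rewrite order_Zp1 prednK // expn_gt0.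
have defG : [set: gT] = <[x]>%g by apply: Zp_cycle.
pose f j : {group gT} := <[x ^+ (2 ^ j)]>%G.
have cf j : #|f j| = (2 ^ (e - j))%N by rewrite -orderE (orderXexp _ ox).
have cyc : cyclic [set: gT] by rewrite defG cycle_cyclic.
have norm (N : {group gT}) : (N <| [set: gT])%g.
  by rewrite -sub_abelian_normal ?subsetT // cyclic_abelian.
have fP (N : {group gT}) : exists2 j, (j <= e)%N & N = f j.
  have /dvdn_pfactor : #|N| %| 2 ^ e by rewrite -ox orderE -defG cardSg ?subsetT.
  case=> // l le_l cN; exists (e - l)%N; first exact: leq_subr.
  apply/val_inj/eqP; rewrite (eq_subG_cyclic cyc) ?subsetT // cf cN.
  by rewrite subKn.
have f_inj j k : (j <= e)%N -> (k <= e)%N -> f j = f k -> j = k.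
  move=> le_j le_k /(congr1 (fun N : {group gT} => #|N|)).
  by rewrite !cf => /(expnI (ltnSn 1)); lia.
have le_m (j : 'I_m) : (j <= e)%N by have := ltn_ord j; rewrite /e; lia.
have le_r (j : 'I_r) : (m + j <= e)%N by have := ltn_ord j; rewrite /e; lia.
pose a := (x ^+ (2 ^ m.-1))%g.
have af j : (j <= e)%N -> (a \in f j) = (j < m)%N.
  move=> le_j; rewrite -cycle_subG -(cardSg_cyclic cyc) ?subsetT //.
  have -> : #|<[a]>%g| = (2 ^ (e - m.-1))%N by apply: cf.
  by rewrite cf dvdn_Pexp2l //; lia.
exists gT, a; split.
  rewrite -[RHS]card_ord -(@card_imset _ _ (fun j : 'I_m => f j)); last first.
    by move=> j k /f_inj eq_jk; apply/val_inj/eq_jk.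
  apply: eq_card => N; rewrite inE norm /=; have [j le_j ->] := fP N.
  rewrite af //; apply/idP/imsetP => [jm | [k _ eq_jk]].
    by exists (Ordinal jm).
  by rewrite (f_inj j k).
rewrite -[RHS]card_ord -(@card_imset _ _ (fun j : 'I_r => f (m + j)%N)); last first.
  by move=> j k /f_inj eq_jk; apply/val_inj/(@addnI m)/eq_jk.
apply: eq_card => N; rewrite inE norm /=; have [j le_j ->] := fP N.
rewrite af // -leqNgt; apply/idP/imsetP => [mj | [k _ eq_jk]].
  have jr : (j - m < r)%N by rewrite /e in le_j; lia.
  by exists (Ordinal jr) => //=; rewrite subnKC.
by rewrite (f_inj j (m + k)%N) ?leq_addr.
Qed.

Import Order.TTheory GRing.Theory Num.Theory.

(** * Realising every rational number *)

Lemma DSC_rees (K : finType) (o : K) (gT : finGroupType) (a : gT) :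
  let m := #|[set N : {group gT} | (N <| [set: gT])%g && (a \in N)]| in
  let r := #|[set N : {group gT} | (N <| [set: gT])%g && (a \notin N)]| in
  DSC_coefficient (rees_mul o a) =
    ((m * #|equivalences K| ^ 2 + r)%:R / (m * #|reflexives K| ^ 2 + r)%:R)%R.
Proof.
rewrite /= /DSC_coefficient card_Cong_rees card_Diag_rees.
rewrite !card_rees_data ?diagonal_equivalence //.
exact/equivalences_reflexive/diagonal_equivalence.
Qed.

Lemma rat_fraction (alpha : rat) : (0 < alpha <= 1)%R ->
  exists u v : nat, [/\ (0 < u)%N, (u <= v)%N & alpha = (u%:R / v%:R)%R].
Proof.
case/andP=> alpha_gt0 alpha_le1; exists `|numq alpha|%N, `|denq alpha|%N.
have alphaE : alpha = (`|numq alpha|%:R / `|denq alpha|%:R)%R.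
  rewrite !natr_absz !ger0_norm ?denq_ge0 ?numq_ge0 ?ltW //.
  by rewrite divq_num_den.
split=> //; first by rewrite absz_gt0 numq_eq0 gt_eqF.
move: alpha_le1; rewrite [X in (X <= 1)%R]alphaE.
by rewrite ler_pdivrMr ?mul1r ?ler_nat // ltr0n absz_gt0 denq_neq0.
Qed.

Local Open Scope ring_scope.

Theorem theorem1p2 (alpha : rat) (alpha_gt0 : 0 < alpha) (alpha_le1 : alpha <= 1) :
  exists (S : finType) (mul : SemiGroup.law S),
    (0 < #|S|)%N /\ DSC_coefficient mul = alpha.
Proof.
have /rat_fraction [u [v [u_gt0 le_uv ->]]] : 0 < alpha <= 1 by apply/andP.
have eqv_gt0 (K : finType) : (0 < #|equivalences K|)%N.
  by apply/card_gt0P; exists (diagonal K); apply: diagonal_equivalence.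
have [eq_uv | lt_uv] : u = v \/ (u < v)%N by lia.
  have [gT [a [Em Er]]] := cyclic_2group_chain 0 (ltn0Sn 0).
  exists (unit * gT * unit)%type, (rees_mul tt a); split.
    by apply/card_gt0P; exists (tt, 1%g, tt).
  have -> : DSC_coefficient (rees_mul tt a) = 1.
    rewrite DSC_rees Em Er; suff -> : reflexives unit = equivalences unit.
      by rewrite divff // pnatr_eq0 addn0 mul1n -lt0n expn_gt0 eqv_gt0.
    apply/setP=> R; apply/idP/idP=> [/reflexivesP rR | /equivalences_reflexive//].
    by apply/equivalencesP; split=> // [[] []|[] [] []].
  by rewrite eq_uv divff // pnatr_eq0; lia.
pose K := 'I_v.+1; pose c := #|equivalences K|; pose d := #|reflexives K|.
have vc_d : (v * c <= d)%N.
  by have := leq_card_equivalences (ord0 : K); rewrite card_ord.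
have c_gt0 : (0 < c)%N := eqv_gt0 K.
(* v c^2 <= (v c)^2 <= d^2 <= u d^2 *)
have vc_ud : (v * c ^ 2 <= u * d ^ 2)%N by nia.
have m_gt0 : (0 < v - u)%N by rewrite subn_gt0.
have [gT [a [Em Er]]] := cyclic_2group_chain (u * d ^ 2 - v * c ^ 2) m_gt0.
exists (K * gT * K)%type, (rees_mul (ord0 : K) a); split.
  by apply/card_gt0P; exists (ord0, 1%g, ord0).
(* It remains to check ((v-u) c^2 + r) v = u ((v-u) d^2 + r), r = u d^2 - v c^2. *)
rewrite DSC_rees Em Er -/c -/d.
have d_gt0 : (0 < d)%N by nia.
apply/eqP; rewrite eqr_div ?pnatr_eq0; try nia.
rewrite -!natrM eqr_nat; apply/eqP; nia.
Qed.
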